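(* Let $b\in\mathbb{N}A$, let $v$ be the optimal solution of the integer program $IP_{A,c}(b)$, and let $\tau$ be a face of $\Delta_c$. Then the group relaxation $G^{\tau}(Av)$ solves $IP_{A,c}(Av)$ if and only if there is some standard pair $(u,\tau')$ of $\mathcal{O}_c$ with $\tau\subseteq\tau'$ such that $v$ belongs to $S(u,\tau')$.
   Context: $\mathbb{N}$ denotes the non-negative integers. $A \in \mathbb{Z}^{d\times n}$ is a fixed matrix of rank $d$ with columns $a_1,\dots,a_n$; $\mathrm{cone}(A)=\{Au : u\in\mathbb{R}^n, u\ge 0\}$ is pointed and $\{u\in\mathbb{R}^n: Au=0, u\ge 0\}=\{0\}$; $\mathbb{N}A=\{Au: u\in\mathbb{N}^n\}$. For $b\in\mathbb{N}A$, $IP_{A,c}(b)$ is the program $\min\{c\cdot x: Ax=b, x\in\mathbb{N}^n\}$; $IP_{A,c}$ is the family of these programs. The cost vector $c\in\mathbb{Z}^n$ is generic, i.e. each $IP_{A,c}(b)$, $b\in\mathbb{N}A$, has a unique optimal solution. $\mathcal{O}_c\subset\mathbb{N}^n$ is the set of all optimal solutions of all programs in $IP_{A,c}$. For $\sigma\subseteq\{1,\dots,n\}$, $\bar\sigma$ is the complement, $A_\sigma$ the submatrix of columns indexed by $\sigma$, $x_\sigma$ the subvector indexed by $\sigma$. The regular triangulation $\Delta_c$ is the set of all $\sigma\subseteq\{1,\dots,n\}$ for which there is $y\in\mathbb{R}^d$ with $y\cdot a_j=c_j$ for $j\in\sigma$ and $y\cdot a_j<c_j$ for $j\notin\sigma$;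 its elements are called faces (by genericity, they label a complex of simplicial cones $\mathrm{cone}(A_\sigma)$ with support $\mathrm{cone}(A)$, whose maximal faces have $d$ elements). Group relaxation: for $\tau\in\Delta_c$ and $b\in\mathbb{N}A$, $G^\tau(b)$ is the program $\min\{\tilde c_{\bar\tau}\cdot x_{\bar\tau}: A_\tau x_\tau+A_{\bar\tau}x_{\bar\tau}=b,\ x_{\bar\tau}\ge 0,\ (x_\tau,x_{\bar\tau})\in\mathbb{Z}^n\}$, where $\tilde c_{\bar\tau}$ consists of the coordinates indexed by $\bar\tau$ of $c-c_\sigma A_\sigma^{-1}A$ for any maximal face $\sigma\supseteq\tau$ of $\Delta_c$. $G^\tau(b)$ solves $IP_{A,c}(b)$ if its (unique) optimal solution $x^*\in\mathbb{Z}^n$ is non-negative (equivalently, equals the optimal solution of $IP_{A,c}(b)$). For $u\in\mathbb{N}^n$ and $\tau\in\Delta_c$, $S(u,\tau)=u+\mathbb{N}(e_i: i\in\tau)$, with $e_i$ the unit vectors of $\mathbb{R}^n$. A pair $(u,\tau)$ with $\tau\in\Delta_c$, $u\in\mathcal{O}_c$ is an admissible pair of $\mathcal{O}_c$ if $\mathrm{supp}(u)\subseteq\bar\tau$ and $S(u,\tau)\subseteq\mathcal{O}_c$. An admissible pair $(u,\tau)$ is a standard pair of $\mathcal{O}_c$ if $S(u,\tau)$ is not properly contained in $S(v,\tau')$ for another admissible pair $(v,\tau')$. *)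

(* Defs.v *)
From HB Require Import structures.
From mathcomp Require Import all_boot all_order all_algebra.
From mathcomp Require Import classical_sets reals.

Set Implicit Arguments.
Unset Strict Implicit.
Unset Printing Implicit Defensive.
Import Order.TTheory GRing.Theory Num.Theory.

Local Open Scope classical_set_scope.
Local Open Scope ring_scope.

(* Column indices {1, ..., n} are 'I_n.  Points of N^n, Z^n and R^n are column
   vectors over nat, int and R; cost vectors and dual vectors are row vectors.
   Subsets of {1, ..., n} are finite sets {set 'I_n}; all other sets are
   classical sets. *)

Definition toR (R : realType) m n (M : 'M[int]_(m, n)) : 'M[R]_(m, n) :=
  map_mx intr M.

Definition natZ n (x : 'cV[nat]_n) : 'cV[int]_n := map_mx Posz x.

Definition nonneg (K : numDomainType) n : set 'cV[K]_n :=
  [set u | forall j, 0 <= u j 0].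

Definition cone (R : realType) d n (A : 'M[int]_(d, n)) : set 'cV[R]_d :=
  [set toR R A *m u | u in @nonneg R n].

Arguments cone R {d n} A.

Definition pointed (R : realType) d (C : set 'cV[R]_d) : Prop :=
  C `&` [set - x | x in C] = [set 0].

Definition NA d n (A : 'M[int]_(d, n)) : set 'cV[int]_d :=
  [set A *m natZ u | u in [set: 'cV[nat]_n]].

Definition cost n (c : 'rV[int]_n) (x : 'cV[int]_n) : int :=
  \sum_j c 0 j * x j 0.

Definition IP_feasible d n (A : 'M[int]_(d, n)) (b : 'cV[int]_d) :
    set 'cV[nat]_n :=
  [set x | A *m natZ x = b].

Definition IP_optimal d n (A : 'M[int]_(d, n)) (c : 'rV[int]_n)
    (b : 'cV[int]_d) : set 'cV[nat]_n :=
  [set x | IP_feasible A b x /\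
     forall y, IP_feasible A b y -> cost c (natZ x) <= cost c (natZ y)].

Definition generic d n (A : 'M[int]_(d, n)) (c : 'rV[int]_n) : Prop :=
  forall b, NA A b -> exists! x, IP_optimal A c b x.

Definition opt_set d n (A : 'M[int]_(d, n)) (c : 'rV[int]_n) :
    set 'cV[nat]_n :=
  [set x | exists2 b, NA A b & IP_optimal A c b x].

Definition faces (R : realType) d n (A : 'M[int]_(d, n)) (c : 'rV[int]_n) :
    set {set 'I_n} :=
  [set sigma : {set 'I_n} | exists y : 'rV[R]_d,
     (forall j, j \in sigma -> (y *m toR R A) 0 j = (c 0 j)%:~R) /\
     (forall j, j \notin sigma -> (y *m toR R A) 0 j < (c 0 j)%:~R)].

Definition maximal_face (R : realType) d n (A : 'M[int]_(d, n))
    (c : 'rV[int]_n) (sigma : {set 'I_n}) : Prop :=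
  faces R A c sigma /\
  forall sigma', faces R A c sigma' -> sigma \subset sigma' -> sigma' = sigma.

Definition subcols (T : Type) m n (sigma : {set 'I_n}) (M : 'M[T]_(m, n)) :
    'M[T]_(m, #|sigma|) :=
  colsub (fun k : 'I_#|sigma| => enum_val k) M.

(* The vector c - c_sigma A_sigma^-1 A.  When A has rank d and c is generic, for a
   maximal face sigma the matrix
   A_sigma has d columns and is invertible, so that pinvmx is its two-sided
   inverse (mulmxVp, mulVpmx); pinvmx is used because the width #|sigma| of
   A_sigma is not syntactically d. *)
Definition reduced_cost (R : realType) d n (A : 'M[int]_(d, n))
    (c : 'rV[int]_n) (sigma : {set 'I_n}) : 'rV[R]_n :=
  toR R c - subcols sigma (toR R c) *m pinvmx (subcols sigma (toR R A))
              *m toR R A.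

Definition GR_feasible d n (A : 'M[int]_(d, n)) (tau : {set 'I_n})
    (b : 'cV[int]_d) : set 'cV[int]_n :=
  [set x | A *m x = b /\ forall j, j \notin tau -> 0 <= x j 0].

Definition GR_cost (R : realType) d n (A : 'M[int]_(d, n)) (c : 'rV[int]_n)
    (tau sigma : {set 'I_n}) (x : 'cV[int]_n) : R :=
  \sum_(j | j \notin tau) reduced_cost R A c sigma 0 j * (x j 0)%:~R.

Definition GR_optimal (R : realType) d n (A : 'M[int]_(d, n))
    (c : 'rV[int]_n) (tau sigma : {set 'I_n}) (b : 'cV[int]_d) :
    set 'cV[int]_n :=
  [set x | GR_feasible A tau b x /\
     forall y, GR_feasible A tau b y ->
       GR_cost R A c tau sigma x <= GR_cost R A c tau sigma y].

(* The maximal face sigma containing tau only serves to define the cost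
   vector of the group relaxation G^tau(b). *)
Definition GR_solves (R : realType) d n (A : 'M[int]_(d, n))
    (c : 'rV[int]_n) (tau sigma : {set 'I_n}) (b : 'cV[int]_d) : Prop :=
  exists x, unique (GR_optimal R A c tau sigma b) x /\ nonneg x.

Definition translates n (u : 'cV[nat]_n) (tau : {set 'I_n}) :
    set 'cV[nat]_n :=
  [set u + \sum_(i in tau) delta_mx i 0 *+ k i | k in [set: 'I_n -> nat]].

Definition supp n (u : 'cV[nat]_n) : {set 'I_n} :=
  finset (fun j => u j 0 != 0).

Definition admissible_pair (R : realType) d n (A : 'M[int]_(d, n))
    (c : 'rV[int]_n) (u : 'cV[nat]_n) (tau : {set 'I_n}) : Prop :=
  [/\ faces R A c tau, opt_set A c u, supp u \subset (~: tau)%SET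
    & translates u tau `<=` opt_set A c].

Definition standard_pair (R : realType) d n (A : 'M[int]_(d, n))
    (c : 'rV[int]_n) (u : 'cV[nat]_n) (tau : {set 'I_n}) : Prop :=
  admissible_pair R A c u tau /\
  ~ exists w tau', admissible_pair R A c w tau' /\
      translates u tau `<` translates w tau'.

(* Main.v *)
Require Import Defs.
From mathcomp Require Import all_boot all_order all_algebra.
From mathcomp Require Import classical_sets reals.
From mathcomp Require boolp.
Import Order.TTheory GRing.Theory Num.Theory.
Local Open Scope classical_set_scope.
Local Open Scope ring_scope.

(** Both sides of the equivalence say that every point of [translates v tau]
    is an optimal solution.

    On the side of the group relaxation, let [y] be a dual vector witnessing
    that [sigma] is a face.  As [sigma] is maximal, its columns span the whole
    space ([maximal_face_row_free]), so the reduced cost of [sigma] is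
    [c - y A]; it vanishes on [sigma], hence on [tau].  The objective of the
    relaxation therefore differs from [c . x] only by the constant [y . b]
    ([GR_costE]), and the relaxation is the original program without the sign
    constraints on [tau].  Adding a large multiple of the unit vectors of [tau]
    to an integral competitor of [v] makes it non-negative, so [v] beats all
    these competitors exactly when all its translates along [tau] are optimal
    ([relaxed_optimal_translates]); genericity of [c] excludes ties
    ([GR_solves_translates]).

    On the side of standard pairs, suppose that all translates of [v] along
    [tau] are optimal.  Optimal solutions are closed under going down
    coordinatewise ([opt_set_down]), so the same holds after the coordinates of
    [v] in [tau] are erased, and this gives an admissible pair whose translates
    contain [v].  An inclusion between the translates of two admissible pairs is
    proper only if the face grows ([translates_proper_card]), so passing to
    larger pairs reaches a standard pair ([admissible_standard]).  If conversely
    [v] lies in [translates u tau'] with [tau] contained in [tau'], then so do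
    the translates of [v] along [tau] ([translates_trans]). *)

(** * Translates of a point along a face *)

Lemma natZD n (x y : 'cV[nat]_n) : natZ (x + y) = natZ x + natZ y.
Proof. by apply/matrixP => i j; rewrite !mxE PoszD. Qed.

Lemma translatesP {n} {u : 'cV[nat]_n} {tau : {set 'I_n}} {v : 'cV[nat]_n} :
  translates u tau v <->
  (forall i, (u i 0%R <= v i 0%R)%N) /\
  (forall i, i \notin tau -> v i 0 = u i 0).
Proof.
have entry (k : 'I_n -> nat) i :
    (u + \sum_(j in tau) delta_mx j 0 *+ k j) i 0 =
    (u i 0%R + (if i \in tau then k i else 0))%N.
  rewrite mxE summxE; congr (_ + _)%N.
  under eq_bigr => j _ do
    (rewrite mulmxnE mxE eqxx andbT eq_sym).
  rewrite big_mkcond (bigD1 i) //= eqxx big1 ?addr0.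
    by case: (i \in tau) => //; exact: natn.
  by move=> j /negbTE nij; rewrite nij mul0rn if_same.
split=> [[k _ <-]|[le_uv eq_uv]].
  split=> i; rewrite entry; first exact: leq_addr.
  by move/negbTE->; rewrite addn0.
exists (fun i => (v i 0%R - u i 0%R)%N) => //.
apply/matrixP=> i j; rewrite ord1 entry.
by case: ifPn => [_|/eq_uv->]; rewrite ?subnKC ?addn0.
Qed.

Lemma translates_refl n (u : 'cV[nat]_n) tau : translates u tau u.
Proof. exact/translatesP. Qed.

Lemma translates_add_on n (u m : 'cV[nat]_n) (tau : {set 'I_n}) :
  (forall i, i \notin tau -> m i 0 = 0%N) -> translates u tau (u + m).
Proof.
move=> m0; apply/translatesP; split=> i; rewrite mxE; first exact: leq_addr.
by move/m0->; rewrite addr0.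
Qed.

Lemma translates_trans n (u v : 'cV[nat]_n) (tau tau' : {set 'I_n}) :
  tau \subset tau' -> translates u tau' v ->
  translates v tau `<=` translates u tau'.
Proof.
move=> /fintype.subsetP sub /translatesP[le_uv eq_uv] w /translatesP[le_vw eq_vw].
apply/translatesP; split=> i; first exact: leq_trans (le_uv i) (le_vw i).
by move=> ni; rewrite eq_vw ?eq_uv //; apply: contra ni; apply: sub.
Qed.

(** The translates recover the face: they are unbounded in its directions
    only. *)
Lemma translates_sub_face {n} {u w : 'cV[nat]_n} {tau tau' : {set 'I_n}} :
  translates u tau `<=` translates w tau' -> tau \subset tau'.
Proof.
move=> sub; apply/fintype.subsetP=> i itau; apply/negPn/negP => ni.
have /sub/translatesP[_ /(_ i ni) ui] := translates_refl _ u tau.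
have : translates u tau (u + delta_mx i 0).
  apply: translates_add_on => j nj; rewrite mxE.
  by case: eqP nj => // ->; rewrite itau.
move=> /sub/translatesP[_ /(_ i ni)]; rewrite -ui !mxE !eqxx /=.
by move/eqP; rewrite -[X in X == _]/(_ + 1)%N -[X in _ == X]addn0 eqn_add2l.
Qed.

(** When base points vanish on their faces, translates with the same face are
    equal as soon as one set contains the other, because the base point can then
    be read off.  So a proper inclusion enlarges the face. *)
Lemma translates_proper_card n (u w : 'cV[nat]_n) (tau tau' : {set 'I_n}) :
  supp u \subset (~: tau)%SET -> supp w \subset (~: tau')%SET ->
  translates u tau `<` translates w tau' -> (#|tau| < #|tau'|)%N.
Proof.
move=> supp_u supp_w [sub nsub]; have sub_tau := translates_sub_face sub.
rewrite ltn_neqAle subset_leq_card // andbT; apply/negP => /eqP card_eq.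
have eq_tau : tau = tau' by apply/eqP; rewrite eqEcard sub_tau card_eq leqnn.
have base0 (x : 'cV[nat]_n) i :
    supp x \subset (~: tau)%SET -> i \in tau -> x i 0 = 0%N.
  move=> /fintype.subsetP/(_ i); rewrite !inE => sx itau.
  by apply/eqP/negPn/negP => /sx; rewrite itau.
apply: nsub; rewrite -eq_tau in supp_w sub *.
have /sub/translatesP[_ eq_uw] := translates_refl _ u tau.
suff -> : u = w by [].
apply/matrixP=> i j; rewrite ord1; case: (boolP (i \in tau)) => [itau|/eq_uw //].
by rewrite !base0.
Qed.

(** * Optimal solutions *)

Lemma costD n (c : 'rV[int]_n) (x y : 'cV[int]_n) :
  cost c (x + y) = cost c x + cost c y.
Proof.
by rewrite /cost -big_split; apply: eq_bigr => j _; rewrite mxE mulrDr.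
Qed.

Lemma opt_setP {d n} {A : 'M[int]_(d, n)} {c : 'rV[int]_n} {x : 'cV[nat]_n} :
  opt_set A c x <->
  forall y, A *m natZ y = A *m natZ x -> cost c (natZ x) <= cost c (natZ y).
Proof.
split=> [[b _ [<- min_x]]|min_x] //.
by exists (A *m natZ x); [exists x | split].
Qed.

(** A cheaper replacement for the summand [x] of [x + m] would also be a cheaper
    replacement for [x + m]. *)
Lemma opt_set_addl {d n} {A : 'M[int]_(d, n)} {c : 'rV[int]_n}
    {x m : 'cV[nat]_n} : opt_set A c (x + m) -> opt_set A c x.
Proof.
move=> /opt_setP opt; apply/opt_setP=> y Ay.
rewrite -(lerD2r (cost c (natZ m))) -!costD -!natZD.
by apply: opt; rewrite !natZD !mulmxDr Ay.
Qed.

Lemma opt_set_down {d n} {A : 'M[int]_(d, n)} {c : 'rV[int]_n}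
    {x y : 'cV[nat]_n} :
  (forall i, (x i 0%R <= y i 0%R)%N) -> opt_set A c y -> opt_set A c x.
Proof.
move=> le_xy; have -> : y = x + \col_i (y i 0%R - x i 0%R)%N.
  by apply/matrixP=> i j; rewrite ord1 !mxE -[LHS](subnKC (le_xy i)).
exact: opt_set_addl.
Qed.

Lemma generic_opt_unique {d n} {A : 'M[int]_(d, n)} {c : 'rV[int]_n}
    {x y : 'cV[nat]_n} :
  generic A c -> opt_set A c x -> A *m natZ y = A *m natZ x ->
  cost c (natZ y) <= cost c (natZ x) -> x = y.
Proof.
move=> gen opt_x Ay le_yx.
have [|z [_ uniq_z]] := gen (A *m natZ x); first by exists x.
have /opt_setP min_x := opt_x.
rewrite -(uniq_z x) //; apply: uniq_z; split=> // w Aw.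
exact: le_trans le_yx (min_x w Aw).
Qed.

(** Absolute values on [tau] suffice to make [x + m] non-negative. *)
Lemma nonneg_off_lift n (tau : {set 'I_n}) (x : 'cV[int]_n) :
  (forall j, j \notin tau -> 0 <= x j 0) ->
  exists m w : 'cV[nat]_n,
    (forall i, i \notin tau -> m i 0 = 0%N) /\ natZ w = x + natZ m.
Proof.
move=> x_ge0.
pose m : 'cV[nat]_n := \col_i (if i \in tau then `|x i 0%R|%N else 0%N).
pose w : 'cV[nat]_n := \col_i `|(x + natZ m)%R i 0%R|%N.
exists m, w; split=> [i /negbTE ni|]; first by rewrite mxE ni.
apply/matrixP=> i j; rewrite ord1 mxE mxE gez0_abs // !mxE.
case: ifPn => [_|/x_ge0]; last by rewrite addr0.
by rewrite abszE -lerBlDl sub0r ler_normr lexx orbT.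
Qed.

(** An integral point is [natZ w - natZ m] with [m] supported on [tau] exactly
    when it is non-negative off [tau] ([nonneg_off_lift]); moving [m] to the
    other side of [c v <= c (w - m)] turns comparison with relaxed competitors of
    [v] into comparison of [v + m] with competitors [w] of the original
    program. *)
Lemma relaxed_optimal_translates {d n} {A : 'M[int]_(d, n)} {c : 'rV[int]_n}
    {tau : {set 'I_n}} {v : 'cV[nat]_n} :
  (forall x, GR_feasible A tau (A *m natZ v) x -> cost c (natZ v) <= cost c x)
  <-> translates v tau `<=` opt_set A c.
Proof.
split=> [min_v w /translatesP[le_vw eq_vw]|opt_tr x [Ax x_ge0]].
  apply/opt_setP=> y Ay; pose m : 'cV[nat]_n := \col_i (w i 0%R - v i 0%R)%N.
  have w_eq : w = v + m.
    by apply/matrixP=> i j; rewrite ord1 !mxE -[LHS](subnKC (le_vw i)).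
  have -> : natZ y = (natZ y - natZ m) + natZ m by rewrite subrK.
  rewrite w_eq natZD !(costD _ _ _ (natZ m)) lerD2r; apply: min_v; split=> [|j nj].
    by rewrite mulmxBr Ay w_eq natZD mulmxDr addrK.
  by rewrite !mxE eq_vw // subnn subr0.
have [m [w [m0 w_eq]]] := nonneg_off_lift _ _ _ x_ge0.
have /opt_tr/opt_setP opt_vm : translates v tau (v + m).
  exact: translates_add_on.
rewrite -(lerD2r (cost c (natZ m))) -!costD -w_eq -natZD.
by apply: opt_vm; rewrite w_eq natZD !mulmxDr Ax.
Qed.

(** * Reduced costs *)

(** If the columns of [sigma] do not span, some [z != 0] is orthogonal to them,
    and the dual vector [y] of [sigma] can be moved in the direction [z] or [- z]
    until a new inequality becomes tight, which enlarges the face. *)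
Lemma maximal_face_row_free {R : realType} {d n} {A : 'M[int]_(d, n)}
    {c : 'rV[int]_n} {sigma : {set 'I_n}} :
  \rank (toR R A) = d -> maximal_face R A c sigma ->
  row_free (subcols sigma (toR R A)).
Proof.
move=> rank_A [[y [y_eq y_lt]] sigma_max].
rewrite -kermx_eq0; apply/negPn/negP => /rowV0Pn[z0 /sub_kermxP z0_ker z0_neq0].
have z0_sigma j : j \in sigma -> (z0 *m toR R A) 0 j = 0.
  move=> js; have := congr1 (fun M : 'rV_#|sigma| => M 0 (enum_rank_in js j)) z0_ker.
  by rewrite /subcols mulmx_colsub !mxE enum_rankK_in.
have [z [j0 [z_sigma z_gt0]]] : exists z : 'rV[R]_d, exists j0,
    (forall j, j \in sigma -> (z *m toR R A) 0 j = 0) /\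
    0 < (z *m toR R A) 0 j0.
  have z0A_neq0 : z0 *m toR R A != 0.
    by rewrite mulmx_free_eq0 // /row_free rank_A.
  have [i [j ij]] : exists i j, (z0 *m toR R A) i j != 0.
    by move/matrix0Pn: z0A_neq0.
  rewrite ord1 in ij; case: (ltrgtP 0 ((z0 *m toR R A) 0 j)) => [pos|neg|eq0].
  - by exists z0, j.
  - exists (- z0), j; split=> [k ks|]; rewrite mulNmx mxE ?oppr_gt0 //.
    by rewrite z0_sigma ?oppr0.
  - by rewrite -eq0 eqxx in ij.
pose slope j := (z *m toR R A) 0 j.
(* The distance that [y] can travel before the constraint [j] is violated. *)
pose step j := ((c 0 j)%:~R - (y *m toR R A) 0 j) / slope j.
case: (@Order.TotalTheory.arg_minP _ _ _ j0 (fun j => 0 < slope j) step z_gt0)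
  => j1 j1_gt0 j1_min.
pose y' := y + step j1 *: z.
have y'E j : (y' *m toR R A) 0 j = (y *m toR R A) 0 j + step j1 * slope j.
  by rewrite mulmxDl -scalemxAl mxE [X in _ + X]mxE.
have y_le j : (y *m toR R A) 0 j <= (c 0 j)%:~R.
  by case: (boolP (j \in sigma)) => [/y_eq->|/y_lt/ltW].
have step_ge0 : 0 <= step j1 by rewrite divr_ge0 ?subr_ge0 // ltW.
have y'_le j : (y' *m toR R A) 0 j <= (c 0 j)%:~R.
  rewrite y'E; case: (ltrP 0 (slope j)) => [pos|neg].
    by rewrite -lerBrDl -ler_pdivlMr // j1_min.
  by rewrite -[leRHS]addr0 lerD ?y_le // mulr_ge0_le0.
pose sigma' : {set 'I_n} := finset (fun j => (y' *m toR R A) 0 j == (c 0 j)%:~R).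
have sub : sigma \subset sigma'.
  apply/fintype.subsetP=> j js; rewrite inE y'E /slope z_sigma // mulr0 addr0.
  by rewrite y_eq.
have face' : faces R A c sigma'.
  exists y'; split=> j; rewrite inE; first by move/eqP.
  by move=> ne; rewrite lt_neqAle ne y'_le.
have j1_sigma : j1 \in sigma.
  rewrite -(sigma_max _ face' sub) inE y'E divfK ?(gt_eqF j1_gt0) //.
  by rewrite addrC subrK.
by move: j1_gt0; rewrite /slope z_sigma // ltxx.
Qed.

Lemma reduced_costE {R : realType} {d n} {A : 'M[int]_(d, n)} {c : 'rV[int]_n}
    {sigma : {set 'I_n}} {y : 'rV[R]_d} :
  row_free (subcols sigma (toR R A)) ->
  (forall j, j \in sigma -> (y *m toR R A) 0 j = (c 0 j)%:~R) ->
  reduced_cost R A c sigma = toR R c - y *m toR R A.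
Proof.
move=> free y_eq; rewrite /reduced_cost.
have -> : subcols sigma (toR R c) = y *m subcols sigma (toR R A).
  rewrite /subcols mulmx_colsub; apply/matrixP=> i k.
  by rewrite ord1 mxE mxE [RHS]mxE y_eq // enum_valP.
by rewrite -(mulmxA y) mulmxVp // mulmx1.
Qed.

(** The reduced cost [c - y A] vanishes on [tau], so restricting the sum to the
    complement of [tau] loses nothing, and [y A x] is the constant [y b]. *)
Lemma GR_costE {R : realType} {d n} {A : 'M[int]_(d, n)} {c : 'rV[int]_n}
    {tau sigma : {set 'I_n}} :
  \rank (toR R A) = d -> maximal_face R A c sigma -> tau \subset sigma ->
  exists y : 'rV[R]_d, forall x : 'cV[int]_n,
    GR_cost R A c tau sigma x =
    (cost c x)%:~R - (y *m toR R (A *m x)) 0 0.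
Proof.
move=> rank_A max_sigma /fintype.subsetP sub.
have free := maximal_face_row_free rank_A max_sigma.
have [[y [y_eq _]] _] := max_sigma; exists y => x.
rewrite /GR_cost (reduced_costE free y_eq).
rewrite /toR map_mxM mulmxA -/(toR R A).
rewrite /cost rmorph_sum [(_ *m _) 0 0]mxE -sumrB big_mkcond /=.
apply: eq_bigr => j _; rewrite !mxE rmorphM -mulrBl.
case: ifPn => // /negPn/sub/y_eq; rewrite mxE => ->.
by rewrite subrr mul0r.
Qed.

Lemma GR_optimalP {R : realType} {d n} {A : 'M[int]_(d, n)} {c : 'rV[int]_n}
    {tau sigma : {set 'I_n}} {b : 'cV[int]_d} {x : 'cV[int]_n} :
  \rank (toR R A) = d -> maximal_face R A c sigma -> tau \subset sigma ->
  GR_optimal R A c tau sigma b x <->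
  GR_feasible A tau b x /\
  forall y, GR_feasible A tau b y -> cost c x <= cost c y.
Proof.
move=> rank_A max_sigma sub.
have [y costE] := GR_costE rank_A max_sigma sub.
by split=> -[[Ax x_ge0] min_x]; split=> // z feas_z; move: (min_x z feas_z);
  have [Az _] := feas_z; rewrite !costE Ax Az lerD2r ler_int.
Qed.

(** A non-negative optimum of the relaxation and the optimum [v] of the program
    have the same cost, so [v] is optimal for the relaxation too.  Conversely a
    tie between [v] and an integral competitor would, after translation along
    [tau], be a tie between two solutions of one program. *)
Lemma GR_solves_translates {R : realType} {d n} {A : 'M[int]_(d, n)}
    {c : 'rV[int]_n} {tau sigma : {set 'I_n}} {v : 'cV[nat]_n} :
  \rank (toR R A) = d -> generic A c -> opt_set A c v ->
  maximal_face R A c sigma -> tau \subset sigma ->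
  GR_solves R A c tau sigma (A *m natZ v) <->
  translates v tau `<=` opt_set A c.
Proof.
move=> rank_A gen /opt_setP min_v max_sigma sub.
have optP := GR_optimalP rank_A max_sigma sub.
rewrite -relaxed_optimal_translates; split.
  case=> x [[/optP[[Ax _] min_x] _] x_ge0] z feas_z.
  have x_nat : x = natZ (\col_i `|x i 0%R|%N).
    by apply/matrixP=> i j; rewrite ord1 !mxE gez0_abs.
  apply: le_trans (min_x z feas_z); rewrite x_nat.
  by apply: min_v; rewrite -x_nat.
move=> min_rel; have /relaxed_optimal_translates opt_tr := min_rel.
exists (natZ v); split; last by move=> j; rewrite mxE.
split; first by apply/optP; split=> //; split=> // j _; rewrite mxE.
move=> x /optP[[Ax x_ge0] min_x].
have [m [w [m0 w_eq]]] := nonneg_off_lift _ _ _ x_ge0.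
suff vm_eq : v + m = w by apply: (addIr (natZ m)); rewrite -natZD vm_eq.
apply: (generic_opt_unique gen).
- by apply: opt_tr; apply: translates_add_on.
- by rewrite w_eq natZD !mulmxDr Ax.
- rewrite w_eq natZD !costD lerD2r; apply: min_x.
  by split=> // j _; rewrite mxE.
Qed.

(** * Standard pairs *)

(** A pair that is not standard has an admissible pair properly above it, with a
    larger face; this ascent must stop, as faces have at most [n] elements. *)
Lemma admissible_standard {R : realType} {d n} {A : 'M[int]_(d, n)}
    {c : 'rV[int]_n} {u : 'cV[nat]_n} {tau : {set 'I_n}} :
  admissible_pair R A c u tau ->
  exists w tau', standard_pair R A c w tau' /\
    translates u tau `<=` translates w tau'.
Proof.
have [k] := ubnP (n - #|tau|); elim: k u tau => // k IH u tau lt_k adm.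
case: (boolp.EM (standard_pair R A c u tau)) => [std|nstd].
  by exists u, tau; split.
have [w [tau' [adm' prop]]] : exists w tau', admissible_pair R A c w tau' /\
    translates u tau `<` translates w tau'.
  by apply: boolp.contrapT => none; apply: nstd; split.
have [_ _ supp_u _] := adm; have [_ _ supp_w _] := adm'.
have lt_card := translates_proper_card _ _ _ _ _ supp_u supp_w prop.
have [|w' [tau'' [std sub']]] := IH w tau' _ adm'.
  apply: leq_trans (ltn_sub2l _ lt_card) lt_k.
  by apply: leq_trans lt_card _; rewrite -[X in (_ <= X)%N](card_ord n) max_card.
by exists w', tau''; split=> //; have [sub _] := prop; apply: subset_trans sub'.
Qed.

Lemma translates_opt_standard {R : realType} {d n} {A : 'M[int]_(d, n)}
    {c : 'rV[int]_n} {tau : {set 'I_n}} {v : 'cV[nat]_n} :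
  faces R A c tau ->
  translates v tau `<=` opt_set A c <->
  exists (u : 'cV[nat]_n) (tau' : {set 'I_n}),
    [/\ standard_pair R A c u tau', tau \subset tau' & translates u tau' v].
Proof.
move=> face_tau; split=> [opt_tr|[u [tau' [[[_ _ _ opt_u] _] sub uv]]]]; last first.
  by move=> w /(translates_trans _ _ _ _ _ sub uv); apply: opt_u.
pose u : 'cV[nat]_n := \col_i (if i \in tau then 0%N else v i 0).
have uv : translates u tau v.
  by apply/translatesP; split=> i; rewrite mxE; [case: ifP | move/negbTE->].
have opt_u : translates u tau `<=` opt_set A c.
  (* [x] agrees with [v] off [tau], so it lies below the translate of [v] by
     the part of [x] on [tau]. *)
  move=> x /translatesP[_ x_eq].
  pose m : 'cV[nat]_n := \col_i (if i \in tau then x i 0 else 0%N).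
  have /opt_tr : translates v tau (v + m).
    by apply: translates_add_on => i /negbTE ni; rewrite mxE ni.
  apply: opt_set_down => i; rewrite !mxE.
  case: ifPn => [_|ni]; first exact: leq_addl.
  by rewrite x_eq // mxE (negbTE ni) addr0.
have adm : admissible_pair R A c u tau.
  split=> //; first exact/opt_u/translates_refl.
  by apply/fintype.subsetP=> i; rewrite !inE mxE; case: ifP => //; rewrite eqxx.
have [w [tau' [std sub]]] := admissible_standard adm.
by exists w, tau'; split; [| exact: translates_sub_face sub | exact: sub].
Qed.

Theorem theorem3p11 (R : realType) (d n : nat)
    (A : 'M[int]_(d, n)) (c : 'rV[int]_n)
    (rank_A : \rank (toR R A) = d)
    (cone_A_pointed : pointed (cone R A))
    (kernel_A : [set u : 'cV[R]_n | toR R A *m u = 0 /\ nonneg u] = [set 0])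
    (c_generic : generic A c)
    (b : 'cV[int]_d) (b_NA : NA A b)
    (v : 'cV[nat]_n) (v_opt : IP_optimal A c b v)
    (tau : {set 'I_n}) (tau_face : faces R A c tau)
    (sigma : {set 'I_n}) (sigma_max : maximal_face R A c sigma)
    (tau_sigma : tau \subset sigma) :
  GR_solves R A c tau sigma (A *m natZ v) <->
  exists (u : 'cV[nat]_n) (tau' : {set 'I_n}),
    [/\ standard_pair R A c u tau', tau \subset tau' & translates u tau' v].
Proof.
have opt_v : opt_set A c v by exists b.
rewrite -(translates_opt_standard tau_face).
exact: GR_solves_translates.
Qed.
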